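(* Let $B$ be a unital $C^*$-algebra with a $*$-isomorphism $\psi:B\to M_n\otimes B$ satisfying $\psi(1)=I_n\otimes 1$. Let $A$ be a maximal abelian $*$-subalgebra of $B$ with $\sigma_1(A)\subset A$ and $\sigma_2(A)\subset A$, let $\phi:A\to\mathbb{C}$ be a unital algebra homomorphism extended to a positive contraction $\phi:B\to\mathbb{C}$, and let $D=\phi_1(A)\subset M_n$. Suppose that $A\cap C$ is maximal abelian in $C$. Then $A\cap C=D^\infty$ and $D$ is maximal abelian in $M_n(\mathbb{C})$.
   Context: $M_n=M_n(\mathbb{C})$, $I_n$ its identity. Define $\psi_0=\mathrm{id}_B$ and recursively $\psi_{m+1}=(\mathrm{id}^{\otimes m}\otimes\psi)\circ\psi_m:B\to M_n^{\otimes(m+1)}\otimes B$. Define $\kappa_m:M_n^{\otimes m}\to B$ by $\kappa_m(x)=\psi_m^{-1}(x\otimes 1)$, and let $C$ be the norm closure of $\bigcup_{m\ge1}\kappa_m(M_n^{\otimes m})$. With $f:B\to M_n\otimes B$, $f(b)=I_n\otimes b$, define for $m\ge1$ the shift $\sigma_m=\psi_m^{-1}\circ(\mathrm{id}^{\otimes(m-1)}\otimes f)\circ\psi_{m-1}:B\to B$. For $m\ge1$ define $\phi_m=(\mathrm{id}^{\otimes m}\otimes\phi)\circ\psi_m:B\to M_n^{\otimes m}$. Let $D^{\otimes m}\subset M_n^{\otimes m}$ be the $m$-fold tensor product of $D$ and $D^\infty$ the norm closure of $\bigcup_{m\ge1}\kappa_m(D^{\otimes m})$. *)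

(* Defs.v *)
From mathcomp Require Import all_boot all_algebra.
From mathcomp Require Import reals complex.
Set Implicit Arguments. Unset Strict Implicit. Unset Printing Implicit Defensive.
Import GRing.Theory Num.Theory.
Local Open Scope ring_scope.

Definition is_Cstar_algebra (R : realType) (B : algType R[i])
    (star : B -> B) (nrm : B -> R) : Prop :=
  (forall x, star (star x) = x) /\
  (forall x y, star (x + y) = star x + star y) /\
  (forall (c : R[i]) x, star (c *: x) = Num.conj c *: star x) /\
  (forall x y, star (x * y) = star y * star x) /\
  (forall x, nrm x = 0 -> x = 0) /\
  (forall x y, nrm (x + y) <= nrm x + nrm y) /\
  (forall (c : R[i]) x, ((nrm (c *: x))%:C = `|c| * (nrm x)%:C)%C) /\
  (forall x y, nrm (x * y) <= nrm x * nrm y) /\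
  (forall x, nrm (star x * x) = nrm x ^+ 2) /\
  (forall u : nat -> B,
     (forall e : R, 0 < e -> exists N, forall p q, (N <= p)%N -> (N <= q)%N ->
        nrm (u p - u q) < e) ->
     exists l, forall e : R, 0 < e -> exists N, forall p, (N <= p)%N ->
        nrm (u p - l) < e).

Definition nclosure (R : realType) (B : algType R[i]) (nrm : B -> R)
    (S : B -> Prop) : B -> Prop :=
  fun b => forall e : R, 0 < e -> exists s, S s /\ nrm (b - s) < e.

(* Generic over a carrier T with explicit operations (used for B and for M_n(C)). *)
Definition star_subalg (K T : Type) (zero : T) (add mul : T -> T -> T)
    (scal : K -> T -> T) (st : T -> T) (S : T -> Prop) : Prop :=
  S zero /\ (forall x y, S x -> S y -> S (add x y)) /\
  (forall c x, S x -> S (scal c x)) /\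
  (forall x y, S x -> S y -> S (mul x y)) /\ (forall x, S x -> S (st x)).

Definition abelian_set (T : Type) (mul : T -> T -> T) (S : T -> Prop) : Prop :=
  forall x y, S x -> S y -> mul x y = mul y x.

Definition masa_in (K T : Type) (zero : T) (add mul : T -> T -> T)
    (scal : K -> T -> T) (st : T -> T) (U S : T -> Prop) : Prop :=
  (forall x, S x -> U x) /\ star_subalg zero add mul scal st S /\
  abelian_set mul S /\
  (forall S' : T -> Prop, (forall x, S' x -> U x) ->
     star_subalg zero add mul scal st S' -> abelian_set mul S' ->
     (forall x, S x -> S' x) -> forall x, S' x -> S x).

Definition masa_B (R : realType) (B : algType R[i]) (star : B -> B)
    (U S : B -> Prop) : Prop :=
  masa_in 0 +%R *%R (@GRing.scale _ B) star U S.

Definition mx_adj (R : realType) n (M : 'M[R[i]]_n) : 'M[R[i]]_n :=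
  \matrix_(i, j) Num.conj (M j i).

Definition masa_Mn (R : realType) n (S : 'M[R[i]]_n -> Prop) : Prop :=
  masa_in 0 +%R (@mulmx _ n n n) (@GRing.scale _ 'M[R[i]]_n) (@mx_adj R n)
    (fun _ => True) S.

(* An element of M_n^{(x)m} (x) X is represented as a matrix indexed by
   multi-indices i = (i_1, ..., i_m) : 'I_m -> 'I_n (factor k <-> i_k). *)
Definition Idx n m := 'I_m -> 'I_n.
Definition Mt (X : Type) n m := Idx n m -> Idx n m -> X.
Definition init {n m} (i : Idx n m.+1) : Idx n m := fun k => i (widen_ord (leqnSn m) k).
Definition lastI {n m} (i : Idx n m.+1) : 'I_n := i ord_max.

(* psi_0 = id, psi_{m+1} = (id^{(x)m} (x) psi) o psi_m *)
Fixpoint psi_pow (B : Type) n (psi : B -> 'M[B]_n) (m : nat) : B -> Mt B n m :=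
  match m with
  | 0 => fun b _ _ => b
  | m'.+1 => fun b i j =>
      psi (@psi_pow B n psi m' b (init i) (init j)) (lastI i) (lastI j)
  end.
Arguments psi_pow {B n} psi m _ _ _.

Definition tens1 (R : realType) (B : algType R[i]) n m (x : Mt R[i] n m) : Mt B n m :=
  fun i j => x i j *: 1.

(* graph of sigma_{m+1} = psi_{m+1}^{-1} o (id^{(x)m} (x) f) o psi_m,
   f(b) = I_n (x) b :  sigma_graph psi m a b  <->  b = sigma_{m+1}(a) *)
Definition sigma_graph (R : realType) (B : algType R[i]) n (psi : B -> 'M[B]_n)
    (m : nat) (a b : B) : Prop :=
  psi_pow psi m.+1 b =
    (fun i j => if lastI i == lastI j then psi_pow psi m a (init i) (init j) else 0).

(* C = closure of U_{m>=1} kappa_m(M_n^{(x)m}),  kappa_m(x) = psi_m^{-1}(x (x) 1) *)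
Definition Cset (R : realType) (B : algType R[i]) (nrm : B -> R) n
    (psi : B -> 'M[B]_n) : B -> Prop :=
  nclosure nrm (fun b => exists m, (0 < m)%N /\
                   exists x : Mt R[i] n m, psi_pow psi m b = tens1 B x).

Definition phi1 (R : realType) (B : algType R[i]) n (psi : B -> 'M[B]_n)
    (phi : B -> R[i]) (b : B) : 'M[R[i]]_n :=
  \matrix_(i, j) phi (psi b i j).

(* D^{(x)m} : linear span of elementary tensors d_1 (x) ... (x) d_m, d_k in D *)
Definition tensor_pow (R : realType) n (D : 'M[R[i]]_n -> Prop) (m : nat)
    (x : Mt R[i] n m) : Prop :=
  exists (k : nat) (c : 'I_k -> R[i]) (d : 'I_k -> 'I_m -> 'M[R[i]]_n),
    (forall l r, D (d l r)) /\
    x = (fun i j => \sum_(l < k) c l * \prod_(r < m) d l r (i r) (j r)).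

Definition Dinf (R : realType) (B : algType R[i]) (nrm : B -> R) n
    (psi : B -> 'M[B]_n) (D : 'M[R[i]]_n -> Prop) : B -> Prop :=
  nclosure nrm (fun b => exists m, (0 < m)%N /\
                   exists x : Mt R[i] n m, tensor_pow D x /\ psi_pow psi m b = tens1 B x).

(* Main.v *)
(* Since sigma_1(A) and sigma_2(A) commute with A, the slices of psi(a), a in A, over
   the first tensor factor lie in A = A', and so do those of psi_2(a) over the second
   factor; hence phi_m(A) lies in D^{(x)m}.  The map kappa_m o phi_m is a conditional
   expectation onto kappa_m(M_n^{(x)m}), bounded uniformly in m, so kappa_m(phi_m(c))
   tends to c for c in C; this gives the inclusion of A /\ C in D^infty.  Any x commuting
   with D has kappa_1(x) commuting with every kappa_m(phi_m(c)), c in A /\ C, hence with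
   A /\ C; maximality puts kappa_1(x) in A, so x = phi_1(kappa_1(x)) is in D.  Therefore D
   is maximal abelian and kappa_1(D) lies in A; applying sigma_1 and taking products gives
   the inclusion of D^infty in A /\ C.

   Uniform boundedness avoids spectral theory: for b and h = kappa_m(phi_m(b))
   self-adjoint and |b| < M, the functional w = tau(h^k . h^k) with tau = (Tr (x) phi) o psi_m
   satisfies w((b - h)^2) >= 0 and w(bh) = w(hb) = w(h^2), so w(h^2) <= w(b^2) <= M^2 w(1).
   Hence tau(h^2k) <= M^2k tau(1), and |h|^(2^j) = |h^(2^j)| with a Hilbert-Schmidt bound
   depending on m gives |h| <= M as j grows. *)
Require Import Defs.
From mathcomp Require Import all_boot all_order all_algebra.
From mathcomp Require Import boolp reals complex ring lra.
Import Order.TTheory GRing.Theory Num.Theory.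
Local Open Scope ring_scope.
Set Implicit Arguments. Unset Strict Implicit. Unset Printing Implicit Defensive.

(** * Growth of real powers *)

Lemma expr_unbounded (R : realType) (a K : R) : 1 < a ->
  exists N, forall p, (N <= p)%N -> K < a ^+ p.
Proof.
move=> a1; have d0 : 0 < a - 1 by rewrite subr_gt0.
have bern p : 1 + (a - 1) * p%:R <= a ^+ p.
  elim: p => [|p IH]; first by rewrite mulr0 addr0 expr0.
  have : a * (1 + (a - 1) * p%:R) <= a ^+ p.+1.
    by rewrite exprS ler_wpM2l// ltW// (lt_trans ltr01).
  have : 0 <= (a - 1) ^+ 2 * p%:R by rewrite mulr_ge0// ?sqr_ge0 ?ler0n.
  by rewrite -natr1; nra.
exists (Num.bound (K / (a - 1))) => p Np.
have h : K / (a - 1) < p%:R.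
  rewrite (le_lt_trans (ler_norm _))// (lt_le_trans (archi_boundP (normr_ge0 _)))//.
  by rewrite ler_nat (leq_trans _ Np)// /Num.bound normr_id.
by move: (bern p) h; rewrite ltr_pdivrMr//; lra.
Qed.

Lemma expr_small (R : realType) (q e : R) : 0 <= q -> q < 1 -> 0 < e ->
  exists N, forall p, (N <= p)%N -> q ^+ p < e.
Proof.
rewrite le_eqVlt => /predU1P[<- _ e0|q0 q1 e0].
  by exists 1%N => -[|p]// _; rewrite expr0n.
have [|N HN] := @expr_unbounded R q^-1 e^-1; first by rewrite invf_gt1.
exists N => p /HN; rewrite exprVn ltf_pV2 ?posrE ?exprn_gt0//.
Qed.

(* Power trick: multiplicative constants disappear after taking 2^j-th roots. *)
Lemma le_of_expr_le (R : realType) (x y K : R) : 0 <= x -> 0 < y ->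
  (forall j, x ^+ (2 ^ j) <= K * y ^+ (2 ^ j)) -> x <= y.
Proof.
move=> x0 y0 H; rewrite leNgt; apply/negP => yx.
have [|N /(_ (2 ^ N)%N (ltnW (ltn_expl _ _)))] := @expr_unbounded R (x / y) K.
  by rewrite ltr_pdivlMr// mul1r.
by move/(_ isT); rewrite expr_div_n ltr_pdivlMr ?exprn_gt0// ltNge H.
Qed.

(** * Additive maps and projections onto subspaces *)

Section AdditiveMaps.
Variables (U V : zmodType) (f : U -> V).
Hypothesis fD : forall x y, f (x + y) = f x + f y.

Lemma addmap0 : f 0 = 0.
Proof. by apply: (@addrI _ (f 0)); rewrite -fD !addr0. Qed.

Lemma addmapN x : f (- x) = - f x.
Proof. by apply/eqP; rewrite -addr_eq0 -fD addNr addmap0. Qed.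

Lemma addmapB x y : f (x - y) = f x - f y.
Proof. by rewrite fD addmapN. Qed.

Lemma addmap_sum (I : Type) (r : seq I) (P : pred I) (F : I -> U) :
  f (\sum_(i <- r | P i) F i) = \sum_(i <- r | P i) f (F i).
Proof. exact: (big_morph _ fD addmap0). Qed.

End AdditiveMaps.

(** Take a subspace of maximal dimension inside [D]: a vector of [D] outside it could be adjoined,
    contradicting maximality. *)
Lemma max_subspace (K : fieldType) (vT : vectType K) (D : vT -> Prop) :
  D 0 -> (forall x y, D x -> D y -> D (x + y)) -> (forall c x, D x -> D (c *: x)) ->
  exists V : {vspace vT}, forall v, D v <-> v \in V.
Proof.
move=> D0 DD DZ.
pose P d := `[< exists V : {vspace vT}, (forall v, v \in V -> D v) /\ \dim V = d >].
have exP : exists d, P d.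
  exists 0; apply/asboolP; exists 0%VS; split; last by rewrite dimv0.
  by move=> v; rewrite memv0 => /eqP->.
have ubP d : P d -> (d <= dim vT)%N.
  by move=> /asboolP[V [_ <-]]; rewrite -dimvf dimvS ?subvf.
case: (ex_maxnP exP ubP) => d /asboolP[V [VD dV]] dmax.
exists V => v; split => [Dv|/VD//]; apply: contraT => vV.
have : P (\dim (V + <[v]>)).
  apply/asboolP; exists (V + <[v]>)%VS; split=> // w /memv_addP[x /VD Dx [y]].
  by case/vlineP => k -> ->; apply: DD => //; apply: DZ.
move=> /dmax; rewrite -dV leqNgt => /negP[].
rewrite (ltn_leqif (dimv_leqif_sup (addvSl _ _))).
apply: contra vV => /subvP; apply; apply: (subvP (addvSr _ _)); exact: memv_line.
Qed.

Lemma linear_projection (K : fieldType) (vT : vectType K) (D : vT -> Prop) :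
  D 0 -> (forall x y, D x -> D y -> D (x + y)) -> (forall c x, D x -> D (c *: x)) ->
  exists P : 'End(vT), (forall x, D (P x)) /\ (forall x, D x -> P x = x).
Proof.
move=> D0 DD DZ; have [V HV] := max_subspace D0 DD DZ.
exists (projv V); split=> x; first by apply/HV/memv_proj.
by move=> /HV/projv_id.
Qed.

(** * Tensor powers *)

Section MultiIndices.
Variables n m : nat.

Definition consI (i0 : 'I_n) (i : Idx n m) : Idx n m.+1 :=
  fun k => if unlift ord0 k is Some k' then i k' else i0.

Definition tailI (i : Idx n m.+1) : Idx n m := fun k => i (lift ord0 k).

Lemma consI0 i0 i : consI i0 i ord0 = i0.
Proof. by rewrite /consI unlift_none. Qed.

Lemma consI_lift i0 i k : consI i0 i (lift ord0 k) = i k.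
Proof. by rewrite /consI liftK. Qed.

Lemma tailIK i0 i : tailI (consI i0 i) = i.
Proof. by apply/funext => k; exact: consI_lift. Qed.

Lemma consI_eta (i : Idx n m.+1) : consI (i ord0) (tailI i) = i.
Proof. by apply/funext => k; rewrite /consI; case: unliftP => [k'|] ->. Qed.

End MultiIndices.

(* [psi_pow] peels off the last tensor factor; here the first one. *)
Lemma psi_powS (T : Type) n (psi : T -> 'M[T]_n) m b (i j : Idx n m.+1) :
  psi_pow psi m.+1 b i j = psi_pow psi m (psi b (i ord0) (j ord0)) (tailI i) (tailI j).
Proof.
elim: m i j => [|m IH] i j; first by rewrite [LHS]/= /Defs.lastI (_ : ord_max = ord0)//; exact: val_inj.
have initT (k : Idx n m.+2) : tailI (init k) = init (tailI k).
  by apply/funext => l; congr (k _); exact: val_inj.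
have lastT (k : Idx n m.+2) : Defs.lastI (tailI k) = Defs.lastI k.
  by congr (k _); exact: val_inj.
have init0 (k : Idx n m.+2) : init k ord0 = k ord0 by congr (k _); exact: val_inj.
rewrite -[LHS]/(psi (psi_pow psi m.+1 b (init i) (init j)) (Defs.lastI i) (Defs.lastI j)) IH.
by rewrite !initT !init0 -(lastT i) -(lastT j).
Qed.

Lemma psi_pow_cons (T : Type) n (psi : T -> 'M[T]_n) m b i0 j0 (i j : Idx n m) :
  psi_pow psi m.+1 b (consI i0 i) (consI j0 j) = psi_pow psi m (psi b i0 j0) i j.
Proof. by rewrite psi_powS !consI0 !tailIK. Qed.

Section TensorPower.
Variables (R : realType) (n : nat) (D : 'M[R[i]]_n -> Prop).

Lemma tensor_pow0 m : @tensor_pow R n D m (fun _ _ => 0).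
Proof.
exists 0, (fun _ => 0), (fun _ _ => 0); split; first by case.
by apply/funext => i; apply/funext => j; rewrite big_ord0.
Qed.

Lemma tensor_powD m (x y : Mt R[i] n m) : tensor_pow D x -> tensor_pow D y ->
  tensor_pow D (fun i j => x i j + y i j).
Proof.
move=> [k [c [d [Dd ->]]]] [k' [c' [d' [Dd' ->]]]].
exists (k + k')%N, (fun l => match split l with inl a => c a | inr a => c' a end),
  (fun l => match split l with inl a => d a | inr a => d' a end).
split=> [l r|]; first by case: split.
apply/funext => i; apply/funext => j; rewrite big_split_ord /=.
by congr (_ + _); apply: eq_bigr => l _; rewrite -?[lshift _ _]/(unsplit (inl _))
  -?[rshift _ _]/(unsplit (inr _)) unsplitK.
Qed.

Lemma tensor_pow_sum m (I : Type) (r : seq I) (x : I -> Mt R[i] n m) :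
  (forall a, tensor_pow D (x a)) -> tensor_pow D (fun i j => \sum_(a <- r) x a i j).
Proof.
move=> H; elim: r => [|a r IH].
  rewrite (_ : (fun _ _ => _) = fun _ _ => 0); first exact: tensor_pow0.
  by apply/funext => i; apply/funext => j; rewrite big_nil.
rewrite (_ : (fun _ _ => _) = fun i j => x a i j + \sum_(a <- r) x a i j).
  exact: tensor_powD.
by apply/funext => i; apply/funext => j; rewrite big_cons.
Qed.

Lemma tensor_pow_cons m (M : 'M[R[i]]_n) (x : Mt R[i] n m) : D M -> tensor_pow D x ->
  tensor_pow D (fun i j => M (i ord0) (j ord0) * x (tailI i) (tailI j)).
Proof.
move=> DM [k [c [d [Dd ->]]]].
exists k, c, (fun l r => if unlift ord0 r is Some r' then d l r' else M).
split=> [l r|]; first by case: unlift.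
apply/funext => i; apply/funext => j; rewrite mulr_sumr; apply: eq_bigr => l _.
rewrite big_ord_recl unlift_none mulrCA; congr (_ * (_ * _)).
by apply: eq_bigr => r _; rewrite liftK.
Qed.

Hypotheses (D0 : D 0) (DD : forall M N, D M -> D N -> D (M + N))
  (DZ : forall c M, D M -> D (c *: M)).

(* The intersection of D (x) M_n^{(x)m} and M_n (x) D^{(x)m} is D^{(x)m+1}: apply a
   projection onto D to the first factor. *)
Lemma tensor_pow_slices m (x : Mt R[i] n m.+1) :
  (forall i0 j0, tensor_pow D (fun i j => x (consI i0 i) (consI j0 j))) ->
  (forall i j, D (\matrix_(i0, j0) x (consI i0 i) (consI j0 j))) ->
  tensor_pow D x.
Proof.
have [P [PD Pid]] := linear_projection D0 DD DZ => xD Dx.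
(* Expand the first factor in matrix units and replace each unit by its image under [P]. This does
   not change x, because [P] fixes every slice of x over the first factor. *)
rewrite (_ : x = fun i j => \sum_(p : 'I_n * 'I_n) P (delta_mx p.1 p.2) (i ord0) (j ord0) *
    x (consI p.1 (tailI i)) (consI p.2 (tailI j))).
  by apply: tensor_pow_sum => -[k l]; apply: (tensor_pow_cons _ (xD k l)).
apply/funext => i; apply/funext => j.
set X := \matrix_(i0, j0) x (consI i0 (tailI i)) (consI j0 (tailI j)).
have -> : x i j = X (i ord0) (j ord0) by rewrite mxE !consI_eta.
rewrite -(Pid X (Dx _ _)) {1}[X]matrix_sum_delta pair_bigA /= linear_sum summxE.
by apply: eq_bigr => p _; rewrite linearZ !mxE mulrC.
Qed.

End TensorPower.

(** * C*-algebras *)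

Section CstarAlgebra.
Variables (R : realType) (B : algType R[i]) (star : B -> B) (nrm : B -> R).
Hypothesis cstar : is_Cstar_algebra star nrm.

Lemma starK x : star (star x) = x.
Proof. by case: cstar. Qed.

Lemma starD x y : star (x + y) = star x + star y.
Proof. by case: cstar => _ []. Qed.

Lemma starZ (c : R[i]) x : star (c *: x) = Num.conj c *: star x.
Proof. by case: cstar => _ [_ []]. Qed.

Lemma starM x y : star (x * y) = star y * star x.
Proof. by case: cstar => _ [_ [_ []]]. Qed.

Lemma nrm_eq0 x : nrm x = 0 -> x = 0.
Proof. by case: cstar => _ [_ [_ [_ [H _]]]] /H. Qed.

Lemma nrmD x y : nrm (x + y) <= nrm x + nrm y.
Proof. by case: cstar => _ [_ [_ [_ [_ [H _]]]]]; apply: H. Qed.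

Lemma nrmZ (c : R[i]) x : (nrm (c *: x))%:C%C = `|c| * (nrm x)%:C%C.
Proof. by case: cstar => _ [_ [_ [_ [_ [_ [H _]]]]]]; apply: H. Qed.

Lemma nrmM x y : nrm (x * y) <= nrm x * nrm y.
Proof. by case: cstar => _ [_ [_ [_ [_ [_ [_ [H _]]]]]]]; apply: H. Qed.

Lemma nrm_cstar x : nrm (star x * x) = nrm x ^+ 2.
Proof. by case: cstar => _ [_ [_ [_ [_ [_ [_ [_ [H _]]]]]]]]; apply: H. Qed.

Lemma nrm_complete (u : nat -> B) :
  (forall e : R, 0 < e -> exists N, forall p q, (N <= p)%N -> (N <= q)%N ->
        nrm (u p - u q) < e) ->
  exists l, forall e : R, 0 < e -> exists N, forall p, (N <= p)%N ->
        nrm (u p - l) < e.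
Proof. by case: cstar => _ [_ [_ [_ [_ [_ [_ [_ [_ H]]]]]]]]; apply: H. Qed.

Lemma star0 : star 0 = 0. Proof. exact: addmap0 starD. Qed.
Lemma starB x y : star (x - y) = star x - star y. Proof. exact: (addmapB starD). Qed.

Lemma star1 : star 1 = 1.
Proof. by rewrite -[LHS]mulr1 -{2}[1]starK -starM mulr1 starK. Qed.

Lemma star_exp x k : star x = x -> star (x ^+ k) = x ^+ k.
Proof.
move=> sx; elim: k => [|k IH]; first by rewrite expr0 star1.
by rewrite exprS starM IH sx -exprSr exprS.
Qed.

Lemma nrmZr (c : R) x : nrm (c%:C%C *: x) = `|c| * nrm x.
Proof. by apply: complexI; rewrite nrmZ rmorphM normc_def/= expr0n addr0 sqrtr_sqr. Qed.

Lemma nrm0 : nrm 0 = 0.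
Proof. by rewrite -(scale0r (0 : B)) (nrmZr 0) normr0 mul0r. Qed.

Lemma nrmN x : nrm (- x) = nrm x.
Proof. by rewrite -scaleN1r; apply: complexI; rewrite nrmZ normrN1 mul1r. Qed.

Lemma nrm_i x : nrm ('i%C *: x) = nrm x.
Proof.
by apply: complexI; rewrite nrmZ normc_def /= expr0n expr1n add0r sqrtr1 mul1r.
Qed.

Lemma nrm_ge0 x : 0 <= nrm x.
Proof. by have := nrmD x (- x); rewrite subrr nrm0 nrmN; lra. Qed.

Lemma nrmB x y : nrm (x - y) <= nrm x + nrm y.
Proof. by rewrite (le_trans (nrmD _ _))// nrmN. Qed.

Lemma nrm_distC x y : nrm (x - y) = nrm (y - x).
Proof. by rewrite -nrmN opprB. Qed.

Lemma nrm_sum (I : Type) (r : seq I) (F : I -> B) :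
  nrm (\sum_(i <- r) F i) <= \sum_(i <- r) nrm (F i).
Proof.
elim/big_rec2: _ => [|i y x _ H]; first by rewrite nrm0.
by rewrite (le_trans (nrmD _ _))// lerD2l.
Qed.

(** The C*-identity and submultiplicativity give |y|^2 <= |star y| |y|; divide by |y|. *)
Lemma nrm_star x : nrm (star x) = nrm x.
Proof.
suff H y : nrm y <= nrm (star y) by apply/le_anti; rewrite H -{2}[x]starK H.
have [->|y0] := eqVneq (nrm y) 0; first exact: nrm_ge0.
have yp : 0 < nrm y by rewrite lt0r y0 nrm_ge0.
by have := nrmM (star y) y; rewrite nrm_cstar expr2 ler_pM2r.
Qed.

Lemma nrm_sqr x : star x = x -> nrm (x * x) = nrm x ^+ 2.
Proof. by move=> sx; rewrite -{1}sx nrm_cstar. Qed.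

Lemma nrm_exp2 x j : star x = x -> nrm (x ^+ (2 ^ j)) = nrm x ^+ (2 ^ j).
Proof.
move=> sx; elim: j => [|j IH]; first by rewrite expn0 !expr1.
by rewrite expnS mul2n -addnn !exprD nrm_sqr ?star_exp// IH expr2.
Qed.

Lemma nrm_small x (K : R) : 0 <= K -> (forall e, 0 < e -> nrm x <= K * e) -> x = 0.
Proof.
move=> K0 H; apply/nrm_eq0/le_anti; rewrite nrm_ge0 andbT.
apply/ler_addgt0Pr => e e0; rewrite add0r.
have K1 : 0 < K + 1 by rewrite ltr_wpDl.
have /H/le_trans-> // : 0 < e / (K + 1) by rewrite divr_gt0.
by rewrite mulrCA ler_piMr ?ltW// ltr_pdivrMr// mul1r; lra.
Qed.

Lemma nclosure_incl (S : B -> Prop) b : S b -> nclosure nrm S b.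
Proof. by move=> Sb e e0; exists b; rewrite subrr nrm0. Qed.

Lemma nclosure_mono (S S' : B -> Prop) b :
  (forall x, S x -> S' x) -> nclosure nrm S b -> nclosure nrm S' b.
Proof. by move=> SS' H e /H[s [/SS']]; exists s. Qed.

(** * Square roots of 1 - x for self-adjoint x with |x| < 1 *)

Section SquareRoot.
Variable x : B.
Hypotheses (sx : star x = x) (x1 : nrm x < 1).
Let q := nrm x.
(* Fixed-point iteration for (1 - z)^2 = 1 - x. *)
Let z k := iter k (fun w : B => 2^-1 *: (x + w * w)) 0.

Let q0 : 0 <= q. Proof. exact: nrm_ge0. Qed.

Let half_real : 2^-1 = (2^-1 : R)%:C%C :> R[i].
Proof. by rewrite fmorphV rmorphMn rmorph1. Qed.

Let nrm_half (b : B) : nrm (2^-1 *: b) = 2^-1 * nrm b.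
Proof. by rewrite half_real nrmZr ger0_norm// invr_ge0 ler0n. Qed.

Let zS k : z k.+1 = 2^-1 *: (x + z k * z k). Proof. by []. Qed.

Let star_z k : star (z k) = z k.
Proof.
elim: k => [|k IH]; first exact: star0.
by rewrite zS starZ starD starM IH sx fmorphV rmorphMn rmorph1.
Qed.

Let comm_z (w : B) k : w * x = x * w -> w * z k = z k * w.
Proof.
move=> wx; elim: k => [|k IH]; first by rewrite mulr0 mul0r.
by rewrite zS -scalerAl -scalerAr mulrDr mulrDl wx mulrA IH -mulrA IH mulrA.
Qed.

Let nrm_z k : nrm (z k) <= q.
Proof.
elim: k => [|k IH]; first by rewrite nrm0.
rewrite zS nrm_half; have := nrmD x (z k * z k); have := nrmM (z k) (z k).
have := nrm_ge0 (z k); move: IH q0 x1; rewrite -/q; nra.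
Qed.

Let z_step k : nrm (z k.+1 - z k) <= q ^+ k.
Proof.
elim: k => [|k IH].
  by rewrite subr0; apply: le_trans (nrm_z 1) _; rewrite expr0 ltW.
(* The iterates commute, so the difference of squares factors; the sum of two iterates has norm at
   most 2q, so each step shrinks by q. *)
have -> : z k.+2 - z k.+1 = 2^-1 *: ((z k.+1 - z k) * (z k.+1 + z k)).
  rewrite [z k.+2]zS {2}[z k.+1]zS -scalerBr; congr (_ *: _).
  have c : z k.+1 * z k = z k * z k.+1 by apply: comm_z; rewrite comm_z.
  rewrite opprD addrACA subrr add0r mulrBl !mulrDr c opprD addrA.
  by rewrite -[_ + _ - z k * z k.+1]addrA subrr addr0.
rewrite nrm_half exprS; have := nrmM (z k.+1 - z k) (z k.+1 + z k).
have := nrmD (z k.+1) (z k); have := nrm_z k; have := nrm_z k.+1.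
have := nrm_ge0 (z k.+1 - z k); have := nrm_ge0 (z k.+1 + z k); move: IH q0; nra.
Qed.

Let z_dist k j : (1 - q) * nrm (z (k + j) - z k) <= q ^+ k.
Proof.
(* The sharper right-hand side is a telescoping geometric sum, which makes the induction on j
   work. *)
suff : (1 - q) * nrm (z (k + j) - z k) <= q ^+ k - q ^+ (k + j).
  by move/le_trans; apply; rewrite gerBl exprn_ge0.
elim: j => [|j IH]; first by rewrite addn0 !subrr nrm0 mulr0.
have q1 : 0 <= 1 - q by rewrite subr_ge0 ltW.
have -> : z (k + j.+1) - z k = (z (k + j).+1 - z (k + j)) + (z (k + j) - z k).
  by rewrite addnS addrA subrK.
have := ler_wpM2l q1 (nrmD (z (k + j).+1 - z (k + j)) (z (k + j) - z k)).
have := ler_wpM2l q1 (z_step (k + j)); rewrite addnS exprS; move: IH; lra.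
Qed.

Let z_cauchy (e : R) : 0 < e -> exists N, forall p p', (N <= p)%N -> (N <= p')%N ->
  nrm (z p - z p') < e.
Proof.
have q1 : 0 < 1 - q by rewrite subr_gt0.
move=> e0; have [|N HN] := @expr_small R q ((1 - q) * (e / 2)) q0 x1.
  by rewrite mulr_gt0// divr_gt0.
have H p : (N <= p)%N -> nrm (z p - z N) < e / 2.
  move=> Np; rewrite -(ltr_pM2l q1); apply: le_lt_trans (HN N _) => //.
  by have := z_dist N (p - N); rewrite subnKC.
exists N => p p' /H hp /H hp'.
have -> : z p - z p' = (z p - z N) - (z p' - z N) by rewrite opprB addrA subrK.
by have := nrmB (z p - z N) (z p' - z N); lra.
Qed.

(** The limit l of the iteration is self-adjoint and satisfies 2 l = x + l^2, so y = 1 - l works.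
    This replaces functional calculus. *)
Lemma selfadjoint_sqrt : exists y, star y = y /\ 1 - x = y * y.
Proof.
have [l zl] := nrm_complete z_cauchy.
have sl : star l = l.
  apply/eqP; rewrite -subr_eq0; apply/eqP; apply: (@nrm_small _ 2) => // e e0.
  have [N /(_ N (leqnn N)) HN] := zl _ e0.
  have -> : star l - l = (z N - l) - star (z N - l).
    by rewrite starB star_z opprB [RHS]addrC addrA subrK.
  have := nrmB (z N - l) (star (z N - l)); rewrite nrm_star; lra.
have fix_l : 2 *: l = x + l * l.
  apply/eqP; rewrite -subr_eq0; apply/eqP.
  (* In the constant, 2 comes from the linear term, q bounds |z_N|, and |l| comes from the other
     half of z_N^2 - l^2. *)
  apply: (@nrm_small _ (2 + q + nrm l)) => [|e e0].
    by rewrite !addr_ge0 ?nrm_ge0.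
  have [N HN] := zl _ e0.
  have -> : 2 *: l - (x + l * l) =
      2 *: (l - z N.+1) + (z N * (z N - l) + (z N - l) * l).
    have -> : z N * (z N - l) + (z N - l) * l = z N * z N - l * l.
      by rewrite mulrBl mulrBr addrA subrK.
    rewrite zS scalerBr scalerA mulfV ?pnatr_eq0// scale1r !opprD [RHS]addrA.
    by rewrite !addrA subrK.
  have H1 := HN N.+1 (leqnSn N); have H0 := HN N (leqnn N).
  have n2 : nrm (2 *: (l - z N.+1)) = 2 * nrm (z N.+1 - l).
    have -> : 2 = (2 : R)%:C%C :> R[i] by rewrite rmorphMn rmorph1.
    by rewrite nrmZr ger0_norm// nrm_distC.
  have := nrmD (2 *: (l - z N.+1)) (z N * (z N - l) + (z N - l) * l).
  have := nrmD (z N * (z N - l)) ((z N - l) * l).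
  have := nrmM (z N) (z N - l); have := nrmM (z N - l) l; rewrite n2.
  have := nrm_z N; have := nrm_ge0 l; have := nrm_ge0 (z N - l); move: q0; nra.
exists (1 - l); split; first by rewrite starB star1 sl.
have -> : x = 2 *: l - l * l by rewrite fix_l addrK.
rewrite mulrBl mul1r mulrBr mulr1 scaler_nat mulr2n !opprB !opprD.
by rewrite -[RHS]addrA; congr (1 + _); rewrite addrCA.
Qed.

End SquareRoot.

(** * Self-adjoint parts, commutants and positive functionals *)

Lemma star_i_skew x : star ('i%C *: (x - star x)) = 'i%C *: (x - star x).
Proof.
rewrite starZ starB starK -[star x - x]opprB scalerN -scaleNr; congr (_ *: _).
by apply/eqP; rewrite eq_complex /= oppr0 opprK !eqxx.
Qed.

Lemma selfadjoint_decomposition x :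
  x = 2^-1 *: (x + star x) + (- 'i%C * 2^-1) *: ('i%C *: (x - star x)).
Proof.
rewrite scalerA mulrAC mulNr -expr2 sqr_i opprK mul1r -scalerDr addrACA subrr addr0.
by rewrite -mulr2n -[x *+ 2]scaler_nat scalerA mulVf ?pnatr_eq0// scale1r.
Qed.

(** A self-adjoint element commuting with [S] lies with [S] in a common abelian *-subalgebra, so
    maximality absorbs it. A general x reduces to its two self-adjoint parts, which commute with [S]
    because [S] is closed under [star]. *)
Lemma masa_commutant (U S : B -> Prop) x :
  star_subalg 0 +%R *%R (@GRing.scale _ B) star U -> masa_B star U S ->
  U x -> (forall y, S y -> x * y = y * x) -> S x.
Proof.
move=> [U0 [UD [UZ [UM Ust]]]] [SU [[S0 [SD [SZ [SM Sst]]]] [Sab Smax]]].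
have self h : U h -> star h = h -> (forall y, S y -> h * y = y * h) -> S h.
  move=> Uh sh hS.
  (* the bicommutant of S and h *)
  pose S' y := U y /\ forall z, (forall w, S w -> z * w = w * z) -> z * h = h * z ->
    y * z = z * y.
  apply: (Smax S') => [y []//||y y' [_ yc] [_ y'c]|y Sy|]; last first.
  - by split=> // z _ ->.
  - by split=> [|z zS _]; [exact: SU|rewrite zS].
  (* [S'] is abelian: [S] and h commute among themselves, so every y' in [S'] commutes with them and
     is an admissible z for y. *)
  - apply: yc => [w Sw|]; first by apply: y'c => [w' /Sab->|]//; rewrite -hS.
    by apply: y'c => // w /hS.
  split; first by split=> // z _ _; rewrite mulr0 mul0r.
  split=> [y y' [Uy yc] [Uy' y'c]|].
    by split=> [|z zS zh]; [exact: UD|rewrite mulrDl mulrDr yc// y'c].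
  split=> [c y [Uy yc]|].
    by split=> [|z zS zh]; [exact: UZ|rewrite -scalerAl -scalerAr yc].
  split=> [y y' [Uy yc] [Uy' y'c]|y [Uy yc]].
    by split=> [|z zS zh]; [exact: UM|rewrite -mulrA y'c// mulrA yc// mulrA].
  split=> [|z zS zh]; first exact: Ust.
  apply: (can_inj starK); rewrite !starM starK yc// => [w Sw|].
    by apply: (can_inj starK); rewrite !starM starK zS//; exact: Sst.
  by rewrite -sh -!starM zh.
move=> Ux xS.
have xsS y : S y -> star x * y = y * star x.
  by move=> Sy; apply: (can_inj starK); rewrite !starM starK xS//; exact: Sst.
pose h := x + star x; pose k := 'i%C *: (x - star x).
have UB a b : U a -> U b -> U (a - b) by move=> Ua Ub; rewrite -scaleN1r; apply/UD/UZ.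
have Sh : S h.
  apply: self => [||y Sy]; [exact: UD (Ust _ _)|by rewrite starD starK addrC|].
  by rewrite mulrDl mulrDr xS// xsS.
have Sk : S k.
  apply: self => [||y Sy]; [exact/UZ/UB/Ust|exact: star_i_skew|].
  by rewrite -scalerAl -scalerAr mulrBl mulrBr xS// xsS.
rewrite (selfadjoint_decomposition x).
by apply: SD; apply: SZ.
Qed.

Lemma masa_closed (S : B -> Prop) b :
  masa_B star (fun=> True) S -> nclosure nrm S b -> S b.
Proof.
move=> mS clS; apply: (masa_commutant _ mS) => // y Sy.
apply/eqP; rewrite -subr_eq0; apply/eqP; apply: (@nrm_small _ (2 * nrm y)) => [|e /clS[s [Ss bs]]].
  by rewrite mulr_ge0// nrm_ge0.
have -> : b * y - y * b = (b - s) * y - y * (b - s).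
  have [_ [_ [Sab _]]] := mS.
  by rewrite mulrBl mulrBr (Sab s y)// opprB addrA subrK.
have := nrmB ((b - s) * y) (y * (b - s)).
have := nrmM (b - s) y; have := nrmM y (b - s); have := nrm_ge0 y; nra.
Qed.

(** With y the self-adjoint square root of 1 - b^2 / M^2, the claim is 0 <= w (y^2) multiplied by
    M^2. *)
Lemma positive_functional_sqr_le (w : B -> R[i]) (b : B) (M : R) :
  (forall x y, w (x + y) = w x + w y) -> (forall c x, w (c *: x) = c * w x) ->
  (forall x, 0 <= w (star x * x)) ->
  star b = b -> nrm b < M -> w (b * b) <= (M ^+ 2)%:C%C * w 1.
Proof.
move=> wD wZ w_ge0 sb bM; have M0 : 0 < M by rewrite (le_lt_trans (nrm_ge0 b)).
have M2 : 0 < M ^+ 2 by rewrite exprn_gt0.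
pose x := ((M ^+ 2)^-1)%:C%C *: (b * b).
have [||y [sy yE]] := @selfadjoint_sqrt x.
- by rewrite starZ starM sb [Num.conj _]conjc_real.
- rewrite nrmZr nrm_sqr// ger0_norm ?invr_ge0 ?ltW// mulrC ltr_pdivrMr// mul1r.
  by rewrite ltr_pXn2r ?nnegrE ?nrm_ge0// ltW.
have := w_ge0 y; rewrite sy -yE (addmapB wD) wZ subr_ge0 fmorphV mulrC.
by rewrite ler_pdivrMr ?ltcR// mulrC.
Qed.

(** * The conditional expectations onto the matrix subalgebras *)

Section Tower.
Variables (n : nat) (psi : B -> 'M[B]_n) (psi' : 'M[B]_n -> B) (phi : B -> R[i]).
Hypothesis psiD : forall x y, psi (x + y) = psi x + psi y.
Hypothesis psiZ : forall (c : R[i]) x, psi (c *: x) = \matrix_(i, j) (c *: psi x i j).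
Hypothesis psiM : forall x y, psi (x * y) = psi x *m psi y.
Hypothesis psi_star : forall x, psi (star x) = \matrix_(i, j) star (psi x j i).
Hypotheses (psiK : cancel psi psi') (psi'K : cancel psi' psi).
Hypothesis psi1 : psi 1 = 1%:M.
Hypothesis phiD : forall x y, phi (x + y) = phi x + phi y.
Hypothesis phiZ : forall (c : R[i]) x, phi (c *: x) = c * phi x.
Hypothesis phi_ge0 : forall x, 0 <= phi (star x * x).
Hypothesis phi_one : phi 1 = 1.

Lemma psiDE x y i j : psi (x + y) i j = psi x i j + psi y i j.
Proof. by rewrite psiD mxE. Qed.

Lemma psiZE c x i j : psi (c *: x) i j = c *: psi x i j.
Proof. by rewrite psiZ mxE. Qed.

Lemma psiME x y i j : psi (x * y) i j = \sum_k psi x i k * psi y k j.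
Proof. by rewrite psiM mxE. Qed.

Lemma psi_starE x i j : psi (star x) i j = star (psi x j i).
Proof. by rewrite psi_star mxE. Qed.

Lemma psi1E i j : psi 1 i j = (i == j)%:R.
Proof. by rewrite psi1 mxE. Qed.

Lemma psiP x y : (forall i j, psi x i j = psi y i j) -> x = y.
Proof. by move=> H; apply: (can_inj psiK); apply/matrixP. Qed.

(** Positivity at x + c makes c phi(star x) + conj(c) phi(x) real for every scalar c; c = 1 compares
    imaginary parts and c = i compares real parts. *)
Lemma phi_star x : phi (star x) = Num.conj (phi x).
Proof.
have real_sum (c : R[i]) : c * phi (star x) + Num.conj c * phi x \is Num.real.
  have := phi_ge0 (x + c *: 1).
  have -> : phi (star (x + c *: 1) * (x + c *: 1)) =
      (c * phi (star x) + Num.conj c * phi x) + (phi (star x * x) + c * Num.conj c).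
    rewrite starD starZ star1 mulrDl !mulrDr -!scalerAl -!scalerAr !mul1r !mulr1.
    by rewrite !phiD !phiZ phi_one; ring.
  move=> /ger0_real; rewrite rpredDr// rpredD// ger0_real// mul_conjC_ge0//.
move: (real_sum 1) (real_sum 'i%C); case: (phi _) (phi _) => [a b] [c d].
rewrite rmorph1 !mul1r [Num.conj _]/= !complex_real => /eqP bd /eqP ac.
apply/eqP; rewrite [Num.conj _]/= eq_complex /=; lra.
Qed.

(* [matrix_alg m] is the image of kappa_m, and [cexp m] is kappa_m \o phi_m. *)
Fixpoint matrix_alg m (b : B) : Prop :=
  if m is m'.+1 then forall i j, matrix_alg m' (psi b i j) else b = phi b *: 1.

Fixpoint cexp m (b : B) : B :=
  if m is m'.+1 then psi' (\matrix_(i, j) cexp m' (psi b i j)) else phi b *: 1.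

(** The functional (Tr (x) phi) o psi_m, with Tr unnormalised. *)
Fixpoint trace m (b : B) : R[i] :=
  if m is m'.+1 then \sum_i trace m' (psi b i i) else phi b.

Lemma psi_cexp m b i j : psi (cexp m.+1 b) i j = cexp m (psi b i j).
Proof. by rewrite psi'K mxE. Qed.

Lemma cexp_in m b : matrix_alg m (cexp m b).
Proof.
elim: m b => [|m IH] b; first by rewrite /= phiZ phi_one mulr1.
by move=> i j; rewrite psi_cexp.
Qed.

Lemma cexp_id m b : matrix_alg m b -> cexp m b = b.
Proof.
elim: m b => [|m IH] b; first by move=> /= {2}->.
by move=> H; apply: psiP => i j; rewrite psi_cexp IH.
Qed.

Lemma cexpD m x y : cexp m (x + y) = cexp m x + cexp m y.
Proof.
elim: m x y => [|m IH] x y; first by rewrite /= phiD scalerDl.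
by apply: psiP => i j; rewrite psi_cexp !psiDE IH !psi_cexp.
Qed.

Lemma cexpZ m c x : cexp m (c *: x) = c *: cexp m x.
Proof.
elim: m x => [|m IH] x; first by rewrite /= phiZ scalerA.
by apply: psiP => i j; rewrite psi_cexp !psiZE IH psi_cexp.
Qed.

Lemma cexp_star m x : cexp m (star x) = star (cexp m x).
Proof.
elim: m x => [|m IH] x; first by rewrite /= starZ star1 phi_star.
by apply: psiP => i j; rewrite psi_cexp !psi_starE IH psi_cexp.
Qed.

(** [matrix_alg m] is the range of the idempotent [cexp m], so its closure properties follow from
    those of [cexp m]. *)
Lemma matrix_algD m x y : matrix_alg m x -> matrix_alg m y -> matrix_alg m (x + y).
Proof. by move=> /cexp_id <- /cexp_id <-; rewrite -cexpD; exact: cexp_in. Qed.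

Lemma matrix_algZ m c x : matrix_alg m x -> matrix_alg m (c *: x).
Proof. by move=> /cexp_id <-; rewrite -cexpZ; exact: cexp_in. Qed.

Lemma matrix_alg_star m x : matrix_alg m x -> matrix_alg m (star x).
Proof. by move=> /cexp_id <-; rewrite -cexp_star; exact: cexp_in. Qed.

Lemma matrix_alg0 m : matrix_alg m 0.
Proof. by rewrite -(scale0r (cexp m 0)); apply/matrix_algZ/cexp_in. Qed.

Lemma matrix_alg1 m : matrix_alg m 1.
Proof.
elim: m => [|m IH]; first by rewrite /= phi_one scale1r.
by move=> i j; rewrite psi1E; case: eqP => _; [exact: IH | exact: matrix_alg0].
Qed.

(** The module property of a conditional expectation; the right-hand version follows by taking
    adjoints. *)
Lemma cexpMl m w x : matrix_alg m w -> cexp m (w * x) = w * cexp m x.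
Proof.
elim: m w x => [|m IH] w x.
  by move=> /= ->; rewrite -!scalerAl !mul1r phiZ scalerA.
move=> H; apply: psiP => i j; rewrite psi_cexp !psiME (addmap_sum (@cexpD m)).
by apply: eq_bigr => k _; rewrite IH// psi_cexp.
Qed.

Lemma cexpMr m w x : matrix_alg m w -> cexp m (x * w) = cexp m x * w.
Proof.
move=> H; rewrite -[x * w](starK) starM cexp_star cexpMl; last exact: matrix_alg_star.
by rewrite starM !cexp_star !starK.
Qed.

Lemma matrix_algM m x y : matrix_alg m x -> matrix_alg m y -> matrix_alg m (x * y).
Proof. by move=> H /cexp_id <-; rewrite -cexpMl//; exact: cexp_in. Qed.

Lemma matrix_algX m x k : matrix_alg m x -> matrix_alg m (x ^+ k).
Proof.
move=> H; elim: k => [|k IH]; first exact: matrix_alg1.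
by rewrite exprS; apply: matrix_algM.
Qed.

Lemma matrix_algS m x : matrix_alg m x -> matrix_alg m.+1 x.
Proof.
elim: m x => [|m IH] x; last by move=> H i j; apply: IH.
move=> /= -> i j; rewrite psiZE psi1E phiZ -scaler_nat phiZ phi_one !mulr1.
by rewrite scalerA.
Qed.

Lemma matrix_alg_le m m' x : (m <= m')%N -> matrix_alg m x -> matrix_alg m' x.
Proof.
by move=> /subnK <- H; elim: (m' - m)%N => // k IH; apply: matrix_algS.
Qed.

(** * Traces and the uniform norm bound *)

Lemma traceD m x y : trace m (x + y) = trace m x + trace m y.
Proof.
elim: m x y => [|m IH] x y //=; rewrite -big_split; apply: eq_bigr => i _.
by rewrite psiDE IH.
Qed.

Lemma traceZ m c x : trace m (c *: x) = c * trace m x.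
Proof.
elim: m x => [|m IH] x //=; rewrite mulr_sumr; apply: eq_bigr => i _.
by rewrite psiZE IH.
Qed.

Lemma traceS_star m x : trace m.+1 (star x * x) =
  \sum_(p : 'I_n * 'I_n) trace m (star (psi x p.1 p.2) * psi x p.1 p.2).
Proof.
rewrite /= -(pair_bigA _ (fun i j => trace m (star (psi x i j) * psi x i j))) exchange_big.
apply: eq_bigr => j _; rewrite psiME (addmap_sum (@traceD m)).
by apply: eq_bigr => i _; rewrite psi_starE.
Qed.

Lemma trace_ge0 m x : 0 <= trace m (star x * x).
Proof.
elim: m x => [|m IH] x; first exact: phi_ge0.
by rewrite traceS_star; apply: sumr_ge0.
Qed.

Lemma trace_cexp m x : trace m (cexp m x) = trace m x.
Proof.
elim: m x => [|m IH] x; first by rewrite /= phiZ phi_one mulr1.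
by apply: eq_bigr => i _; rewrite -[RHS]IH -psi_cexp.
Qed.

Lemma Re_le (x y : R[i]) : x <= y -> complex.Re x <= complex.Re y.
Proof. by rewrite lecE => /andP[]. Qed.

(** The matrix algebra is finite-dimensional, so a constant depending on m exists. A general linear
    [theta] is needed for the induction: g is the sum of its n^2 blocks, and [theta] on each block
    is a linear map one level down. *)
Lemma hilbert_schmidt_bound m (theta : B -> B) :
  (forall x y, theta (x + y) = theta x + theta y) ->
  (forall c x, theta (c *: x) = c *: theta x) ->
  exists K, 0 <= K /\ forall g, matrix_alg m g ->
    nrm (theta g) <= K * Num.sqrt (complex.Re (trace m (star g * g))).
Proof.
elim: m theta => [|m IH] theta tD tZ.
  exists (nrm (theta 1)); split; first exact: nrm_ge0.
  move=> g /= ->; rewrite tZ; set c := phi g; rewrite -lecR nrmZ rmorphM /= mulrC.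
  rewrite ler_wpM2l ?ler0c ?nrm_ge0// starZ star1 -scalerAl -scalerAr mulr1.
  rewrite !phiZ phi_one mulr1 [Num.conj _ * _]mulrC -normCK.
  have /complex_realP[r ->] := normr_real c.
  by rewrite -rmorphXn /= sqrtr_sqr lecR ler_norm.
pose e (i j : 'I_n) b := theta (psi' (\matrix_(k, l) if (k == i) && (l == j) then b else 0)).
have eP p : exists K, 0 <= K /\ forall g, matrix_alg m g ->
    nrm (e p.1 p.2 g) <= K * Num.sqrt (complex.Re (trace m (star g * g))).
  apply: IH => [x y|c x]; rewrite /e -?tD -?tZ; congr theta; apply: psiP => i j.
    by rewrite psiDE !psi'K !mxE; case: ifP; rewrite ?addr0.
  by rewrite psiZE !psi'K !mxE; case: ifP; rewrite ?scaler0.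
have [K KP] := fin_all_exists eP.
exists (\sum_p K p); split=> [|g Hg]; first by apply: sumr_ge0 => p _; case: (KP p).
have -> : theta g = \sum_p e p.1 p.2 (psi g p.1 p.2).
  rewrite -(addmap_sum tD) ; congr theta; apply: psiP => i j.
  rewrite (addmap_sum (fun x y => psiDE x y i j)) (bigD1 (i, j))//= psi'K mxE !eqxx/=.
  rewrite big1 ?addr0// => -[k l] /= ne; rewrite psi'K mxE; case: andP => // -[/eqP ik /eqP jl].
  by rewrite ik jl eqxx in ne.
apply: le_trans (nrm_sum _ _) _; rewrite mulr_suml; apply: ler_sum => p _.
have [K0 /(_ _ (Hg p.1 p.2))/le_trans] := KP p; apply; rewrite ler_wpM2l// ler_wsqrtr//.
apply: Re_le; rewrite traceS_star (bigD1 p)//= lerDl sumr_ge0// => q _; exact: trace_ge0.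
Qed.

Lemma trace_cexp_pow m b M k : star b = b -> nrm b < M ->
  trace m (cexp m b ^+ (k + k)) <= (M ^+ (k + k))%:C%C * trace m 1.
Proof.
move=> sb bM; set h := cexp m b; have hm : matrix_alg m h by exact: cexp_in.
have sh : star h = h by rewrite -cexp_star sb.
elim: k => [|k IH]; first by rewrite !expr0 mul1r.
have shk := star_exp k sh; have hkm : matrix_alg m (h ^+ k) by exact: matrix_algX.
pose w x := trace m (h ^+ k * x * h ^+ k).
have wD x y : w (x + y) = w x + w y by rewrite /w mulrDr mulrDl traceD.
have wZ c x : w (c *: x) = c * w x by rewrite /w -scalerAr -scalerAl traceZ.
have w_ge0 x : 0 <= w (star x * x).
  by have := trace_ge0 m (x * h ^+ k); rewrite starM shk /w !mulrA.
have w1 : w 1 = trace m (h ^+ (k + k)) by rewrite /w mulr1 -exprD.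
have whh : w (h * h) = trace m (h ^+ (k.+1 + k.+1)).
  by rewrite /w mulrA -exprSr -mulrA -exprS -exprD.
(* [trace m] is invariant under [cexp m], and the powers of h on both sides pull out of [cexp m],
   leaving h in place of b. *)
have wbh : w (b * h) = w (h * h).
  rewrite /w -!mulrA -trace_cexp cexpMl// cexpMr//; apply: (matrix_algM hm hkm).
have whb : w (h * b) = w (h * h).
  by rewrite /w !mulrA -trace_cexp cexpMr// cexpMl//; apply: (matrix_algM hkm hm).
have whhbb : w (h * h) <= w (b * b).
  have := w_ge0 (b - h); rewrite starB sb sh mulrBl !mulrBr !(addmapB wD) wbh whb.
  by rewrite subrr subr0 subr_ge0.
rewrite -whh (le_trans whhbb)// (le_trans (positive_functional_sqr_le wD wZ w_ge0 sb bM))//.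
have -> : M ^+ (k.+1 + k.+1) = M ^+ 2 * M ^+ (k + k) by rewrite -exprD addSn addnS.
by rewrite w1 [in leRHS]rmorphM -mulrA ler_wpM2l// ler0c sqr_ge0.
Qed.

(** The trace estimate at k = 2^j bounds |h|^(2^j) by a constant times M^(2^j). The constant depends
    on m but not on j, so [le_of_expr_le] removes it. The slack e makes |b| < M strict, as the
    square root requires. *)
Lemma nrm_cexp_selfadjoint m b : star b = b -> nrm (cexp m b) <= nrm b.
Proof.
move=> sb; apply/ler_addgt0Pr => e e0; set M := nrm b + e; set h := cexp m b.
have bM : nrm b < M by rewrite ltrDl.
have M0 : 0 < M by rewrite (le_lt_trans (nrm_ge0 b)).
have hm : matrix_alg m h by exact: cexp_in.
have sh : star h = h by rewrite -cexp_star sb.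
have [//|//|K [K0 HK]] := @hilbert_schmidt_bound m id.
apply: (@le_of_expr_le _ _ _ (K * Num.sqrt (complex.Re (trace m 1)))) => [||j].
- exact: nrm_ge0.
- by [].
set N := (2 ^ j)%N; rewrite -nrm_exp2//; apply: le_trans (HK _ (matrix_algX _ hm)) _.
rewrite -mulrA ler_wpM2l// star_exp// -exprD.
have /Re_le := trace_cexp_pow m N sb bM; rewrite -/h => /ler_wsqrtr/le_trans; apply.
have -> (r : R) (c : R[i]) : complex.Re (r%:C%C * c) = r * complex.Re c.
  by case: c => x y /=; rewrite mul0r subr0.
by rewrite exprD -expr2 sqrtrM ?sqr_ge0// sqrtr_sqr ger0_norm ?exprn_ge0 ?(ltW M0)// mulrC.
Qed.

(** The factor 2 comes from adding the bounds for the two self-adjoint parts; what matters is that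
    it does not depend on m. *)
Lemma nrm_cexp m b : nrm (cexp m b) <= 2 * nrm b.
Proof.
have two : 2^-1 = (2^-1 : R)%:C%C :> R[i] by rewrite fmorphV rmorphMn rmorph1.
pose h := b + star b; pose k := 'i%C *: (b - star b).
have sh : star h = h by rewrite starD starK addrC.
have sk : star k = k by exact: star_i_skew.
have nh : nrm h <= 2 * nrm b by have := nrmD b (star b); rewrite nrm_star; lra.
have nk : nrm k <= 2 * nrm b.
  by have := nrmB b (star b); rewrite nrm_i nrm_star; lra.
rewrite {1}[b]selfadjoint_decomposition -/h -/k.
rewrite cexpD (cexpZ _ _ h) (cexpZ _ _ k); apply: le_trans (nrmD _ _) _.
rewrite -scalerA two [nrm (- _ *: _)](_ : _ = nrm ((2^-1)%:C%C *: cexp m k)); last first.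
  by rewrite scaleNr nrmN nrm_i.
rewrite !nrmZr ger0_norm ?invr_ge0 ?ler0n//.
have := nrm_cexp_selfadjoint m sh; have := nrm_cexp_selfadjoint m sk; lra.
Qed.

(** * Iterates of [psi] and the algebra C *)

Lemma psi_powD m x y i j : psi_pow psi m (x + y) i j = psi_pow psi m x i j + psi_pow psi m y i j.
Proof. by elim: m i j => [|m IH] i j //=; rewrite IH psiDE. Qed.

Lemma psi_powZ m c x i j : psi_pow psi m (c *: x) i j = c *: psi_pow psi m x i j.
Proof. by elim: m i j => [|m IH] i j //=; rewrite IH psiZE. Qed.

Lemma psi_pow_inj m x y : psi_pow psi m x = psi_pow psi m y -> x = y.
Proof.
elim: m x y => [|m IH] x y H.
  have i : Idx n 0 by case.
  exact: (congr1 (fun f => f i i) H).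
apply: psiP => i0 j0; apply: IH; apply/funext => i; apply/funext => j.
by rewrite -!psi_pow_cons H.
Qed.

(** Identifies [cexp m] with kappa_m o phi_m: [cexp] recurses on the first tensor factor and
    [psi_pow] on the last, and [psi_powS] reconciles them. *)
Lemma psi_pow_cexp m b :
  psi_pow psi m (cexp m b) = tens1 B (fun i j => phi (psi_pow psi m b i j)).
Proof.
apply/funext => i; apply/funext => j; elim: m b i j => [|m IH] b i j //.
by rewrite psi_powS psi_cexp IH /tens1 psi_powS.
Qed.

Lemma matrix_algP m b : matrix_alg m b <-> exists x : Mt R[i] n m, psi_pow psi m b = tens1 B x.
Proof.
split=> [/cexp_id <-|[x bx]]; first by eexists; exact: psi_pow_cexp.
rewrite (_ : b = cexp m b); first exact: cexp_in.
apply: (@psi_pow_inj m); rewrite psi_pow_cexp; apply/funext => i; apply/funext => j.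
by rewrite bx /tens1 phiZ phi_one mulr1.
Qed.

Lemma CsetP b :
  Cset nrm psi b <-> nclosure nrm (fun b => exists m, (0 < m)%N /\ matrix_alg m b) b.
Proof. by split; apply: nclosure_mono => x [m [m0 /matrix_algP H]]; exists m. Qed.

(** If s in [matrix_alg m] is within e / 3 of c, then [cexp m] fixes s, so the error is that of c -
    s and is at most 3 |c - s|. *)
Lemma cexp_approx c (e : R) : Cset nrm psi c -> 0 < e ->
  exists m, (0 < m)%N /\ nrm (c - cexp m c) < e.
Proof.
move=> /CsetP Cc e0; have [|s [[m [m0 sm]] cs]] := Cc (e / 3); first by rewrite divr_gt0.
exists m; split=> //; have -> : c - cexp m c = (c - s) - cexp m (c - s).
  by rewrite (addmapB (@cexpD m)) (cexp_id sm) opprB addrA subrK.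
have := nrmB (c - s) (cexp m (c - s)); have := nrm_cexp m (c - s); lra.
Qed.

Lemma Cset_star_subalg : star_subalg 0 +%R *%R (@GRing.scale _ B) star (Cset nrm psi).
Proof.
pose S b := exists m, (0 < m)%N /\ matrix_alg m b.
have Sop (op : B -> B -> B) x y :
    (forall m, matrix_alg m x -> matrix_alg m y -> matrix_alg m (op x y)) ->
    S x -> S y -> S (op x y).
  move=> Hop [m [m0 xm]] [m' [m'0 ym]]; exists (maxn m m'); rewrite leq_max m0.
  by split=> //; apply: Hop; [apply: matrix_alg_le xm | apply: matrix_alg_le ym];
    rewrite leq_max leqnn ?orbT.
split; first by apply/CsetP/nclosure_incl; exists 1%N; split=> //; exact: matrix_alg0.
split=> [x y /CsetP Cx /CsetP Cy|].
  apply/CsetP => e e0; have e2 : 0 < e / 2 by rewrite divr_gt0.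
  have [s [Ss xs]] := Cx _ e2; have [t [St yt]] := Cy _ e2.
  exists (s + t); split; first by apply: Sop Ss St => m; exact: matrix_algD.
  have -> : x + y - (s + t) = (x - s) + (y - t) by rewrite opprD addrACA.
  by have := nrmD (x - s) (y - t); lra.
split=> [c x /CsetP Cx|].
  apply/CsetP => e e0; have /complex_realP[r rE] := normr_real c.
  have r0 : 0 <= r by rewrite -ler0c -rE.
  have r1 : 0 < r + 1 by rewrite ltr_wpDl.
  have [|s [[m [m0 sm]] xs]] := Cx (e / (r + 1)); first by rewrite divr_gt0.
  exists (c *: s); split; first by exists m; split=> //; exact: matrix_algZ.
  rewrite -scalerBr; have -> : nrm (c *: (x - s)) = r * nrm (x - s).
    by apply: complexI; rewrite nrmZ rE rmorphM.
  by move: xs; rewrite ltr_pdivlMr//; have := nrm_ge0 (x - s); nra.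
split=> [x y /CsetP Cx /CsetP Cy|].
  apply/CsetP => e e0; set K := nrm x + nrm y + 1.
  have K0 : 0 < K by rewrite ltr_wpDl// addr_ge0// nrm_ge0.
  (* The cap 1 gives |t| <= |y| + 1, so K dominates both |x| and |t|. *)
  have [|t [St yt]] := Cy (Num.min 1 (e / 2 / K)); first by rewrite lt_min ltr01 !divr_gt0.
  have [|s [Ss xs]] := Cx (e / 2 / K); first by rewrite !divr_gt0.
  exists (s * t); split; first by apply: Sop Ss St => m; exact: matrix_algM.
  have -> : x * y - s * t = x * (y - t) + (x - s) * t.
    by rewrite mulrBr mulrBl addrA subrK.
  move: yt xs; rewrite lt_min !ltr_pdivlMr// => /andP[y1 yt] xs.
  have tK : nrm t <= nrm y + 1.
    rewrite -[t](subKr y); have := nrmB y (y - t); lra.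
  have := nrmD (x * (y - t)) ((x - s) * t).
  have := nrmM x (y - t); have := nrmM (x - s) t; move: (nrm_ge0 (x - s)) (nrm_ge0 (y - t)).
  move: (nrm_ge0 x) (nrm_ge0 y) tK yt xs; rewrite /K; nra.
move=> x /CsetP Cx; apply/CsetP => e e0; have [s [[m [m0 sm]] xs]] := Cx e e0.
exists (star s); rewrite -starB nrm_star; split=> //.
by exists m; split=> //; exact: matrix_alg_star.
Qed.

(** * Slices and maximal abelian subalgebras *)

(** The map sigma_1, whose graph is [sigma_graph psi 0]. *)
Definition shift (b : B) : B := psi' b%:M.

Lemma psi_shift b i j : psi (shift b) i j = b *+ (i == j).
Proof. by rewrite psi'K mxE. Qed.

Lemma psi_mul_shift x b i j : psi (x * shift b) i j = psi x i j * b.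
Proof.
rewrite psiME (bigD1 j)//= psi_shift eqxx big1 ?addr0// => k kj.
by rewrite psi_shift (negbTE kj) mulr0.
Qed.

Lemma psi_shift_mul x b i j : psi (shift b * x) i j = b * psi x i j.
Proof.
rewrite psiME (bigD1 i)//= psi_shift eqxx big1 ?addr0// => k ki.
by rewrite psi_shift eq_sym (negbTE ki) mul0r.
Qed.

(** The map kappa_1. *)
Definition embed (x : 'M[R[i]]_n) : B := psi' (\matrix_(i, j) (x i j *: 1)).

Lemma psi_embed x i j : psi (embed x) i j = x i j *: 1.
Proof. by rewrite psi'K mxE. Qed.

Lemma phi1_embed x : phi1 psi phi (embed x) = x.
Proof. by apply/matrixP => i j; rewrite mxE psi_embed phiZ phi_one mulr1. Qed.

Lemma Cset_embed x : Cset nrm psi (embed x).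
Proof.
apply/CsetP/nclosure_incl; exists 1%N; split=> // i j.
by rewrite psi_embed /= phiZ phi_one mulr1.
Qed.

Lemma commute_Cset y c : Cset nrm psi c ->
  (forall m, y * cexp m.+1 c = cexp m.+1 c * y) -> y * c = c * y.
Proof.
move=> Cc H; apply/eqP; rewrite -subr_eq0; apply/eqP.
apply: (@nrm_small _ (2 * nrm y)) => [|e e0]; first by rewrite mulr_ge0// nrm_ge0.
have [[|m] [// _ ce]] := cexp_approx Cc e0.
have -> : y * c - c * y = y * (c - cexp m.+1 c) - (c - cexp m.+1 c) * y.
  by rewrite mulrBl mulrBr H opprB addrA subrK.
have := nrmB (y * (c - cexp m.+1 c)) ((c - cexp m.+1 c) * y).
have := nrmM (c - cexp m.+1 c) y; have := nrmM y (c - cexp m.+1 c).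
have := nrm_ge0 y; nra.
Qed.

(** * Consequences of the maximality of [A] and of its intersection with C *)

Section Masa.
Variable A : B -> Prop.
Hypothesis masaA : masa_B star (fun=> True) A.
Hypothesis A_sigma1 : forall a b, A a -> sigma_graph psi 0 a b -> A b.
Hypothesis A_sigma2 : forall a b, A a -> sigma_graph psi 1 a b -> A b.
Hypothesis phiM : forall a a', A a -> A a' -> phi (a * a') = phi a * phi a'.
Hypothesis masaAC : masa_B star (Cset nrm psi) (fun b => A b /\ Cset nrm psi b).

Let A0 : A 0. Proof. by case: masaA => _ [[]]. Qed.
Let AD x y : A x -> A y -> A (x + y). Proof. by case: masaA => _ [[_ [H _]]] _; apply: H. Qed.
Let AZ c x : A x -> A (c *: x). Proof. by case: masaA => _ [[_ [_ [H _]]]] _; apply: H. Qed.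
Let AM x y : A x -> A y -> A (x * y).
Proof. by case: masaA => _ [[_ [_ [_ [H _]]]]] _; apply: H. Qed.
Let A_star x : A x -> A (star x).
Proof. by case: masaA => _ [[_ [_ [_ [_ H]]]]] _; apply: H. Qed.
Let A_comm x y : A x -> A y -> x * y = y * x.
Proof. by case: masaA => _ [_ [H _]]; apply: H. Qed.
Let A_commutant x : (forall y, A y -> x * y = y * x) -> A x.
Proof. exact: masa_commutant masaA _. Qed.

Lemma A_shift a : A a -> A (shift a).
Proof.
move=> /A_sigma1; apply; apply/funext => i; apply/funext => j.
by rewrite /= psi_shift; case: eqP.
Qed.

(** Applying sigma_1 to every entry of psi(a) yields sigma_2(a). *)
Lemma A_shift2 a : A a -> A (psi' (\matrix_(i, j) shift (psi a i j))).
Proof.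
move=> /A_sigma2; apply; apply/funext => i; apply/funext => j.
by rewrite /= psi'K mxE psi_shift; case: eqP.
Qed.

(** Comparing entries in the commutation of a with sigma_1(y), y in [A], shows that each entry
    commutes with [A]; and [A] is its own commutant. *)
Lemma A_entry a i j : A a -> A (psi a i j).
Proof.
move=> Aa; apply: A_commutant => y /A_shift Ay.
by rewrite -psi_mul_shift (A_comm Aa Ay) psi_shift_mul.
Qed.

(** The same argument with sigma_2(y), which is the identity in the second factor: fixing that
    factor at (k, l) leaves an element commuting with y. *)
Lemma A_slice2 a k l : A a -> A (psi' (\matrix_(i, j) psi (psi a i j) k l)).
Proof.
move=> Aa; apply: A_commutant => y /A_shift2 Ay; apply: psiP => i r.
have := congr1 (fun b => psi (psi b i r) k l) (A_comm Aa Ay).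
rewrite !psiME !(addmap_sum (fun x y => psiDE x y k l)) => H.
transitivity (\sum_j psi (psi a i j * psi (psi' (\matrix_(i, j) shift (psi y i j))) j r) k l).
  by apply: eq_bigr => j _; rewrite !psi'K !mxE psi_mul_shift.
by rewrite H; apply: eq_bigr => j _; rewrite !psi'K !mxE psi_shift_mul.
Qed.

(** Factors 2 to m + 1 are fixed one at a time; after each slice the next factor has become the
    second one, so [A_slice2] applies again. *)
Lemma A_slice a m (i j : Idx n m) :
  A a -> A (psi' (\matrix_(i0, j0) psi_pow psi m (psi a i0 j0) i j)).
Proof.
move=> Aa; elim: m i j => [|m IH] i j.
  rewrite (_ : psi' _ = a)//; apply: psiP => i0 j0; by rewrite psi'K mxE.
have := A_slice2 (Defs.lastI i) (Defs.lastI j) (IH (init i) (init j)).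
by under eq_mx do rewrite psi'K mxE.
Qed.

Let D (M : 'M[R[i]]_n) := exists a, A a /\ M = phi1 psi phi a.

Let D0 : D 0.
Proof.
exists 0; split=> //; apply/matrixP => i j.
by rewrite !mxE (addmap0 (fun x y => psiDE x y i j)) (addmap0 phiD).
Qed.

Let DD M N : D M -> D N -> D (M + N).
Proof.
move=> [a [Aa ->]] [b [Ab ->]]; exists (a + b); split; first exact: AD.
by apply/matrixP => i j; rewrite !mxE psiDE phiD.
Qed.

Let DZ c M : D M -> D (c *: M).
Proof.
move=> [a [Aa ->]]; exists (c *: a); split; first exact: AZ.
by apply/matrixP => i j; rewrite !mxE psiZE phiZ.
Qed.

Lemma phi1M a b : A a -> A b -> phi1 psi phi (a * b) = phi1 psi phi a *m phi1 psi phi b.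
Proof.
move=> Aa Ab; apply/matrixP => i j; rewrite !mxE psiME (addmap_sum phiD).
by apply: eq_bigr => k _; rewrite phiM ?mxE//; exact: A_entry.
Qed.

Let D_abelian M N : D M -> D N -> M *m N = N *m M.
Proof. by move=> [a [Aa ->]] [b [Ab ->]]; rewrite -!phi1M// A_comm. Qed.

(** Fixing the first factor leaves an entry of psi(a), covered by induction through [A_entry];
    fixing the others leaves phi_1 of an element of [A] by [A_slice]. [tensor_pow_slices] combines
    the two. *)
Lemma phi_pow_tensor m a : A a -> tensor_pow D (fun i j => phi (psi_pow psi m a i j)).
Proof.
elim: m a => [|m IH] a Aa.
  (* For m = 0 the product is empty, so the coefficient carries the scalar. *)
  exists 1%N, (fun=> phi a), (fun _ _ => 0); split=> //.
  by apply/funext => i; apply/funext => j; rewrite big_ord1 big_ord0 mulr1.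
apply: (tensor_pow_slices D0 DD DZ) => [i0 j0|i j].
  rewrite (_ : (fun _ _ => _) = fun i j => phi (psi_pow psi m (psi a i0 j0) i j)).
    exact/IH/A_entry.
  by apply/funext => i; apply/funext => j; rewrite psi_pow_cons.
exists (psi' (\matrix_(i0, j0) psi_pow psi m (psi a i0 j0) i j)); split; first exact: A_slice.
by apply/matrixP => i0 j0; rewrite !mxE psi_pow_cons psi'K mxE.
Qed.

(** With factors 2 to m + 1 fixed, phi_(m+1)(a) becomes phi_1 of a slice of a, an element of [D],
    which commutes with x. *)
Lemma embed_comm_cexp x m a : (forall M, D M -> x *m M = M *m x) -> A a ->
  embed x * cexp m.+1 a = cexp m.+1 a * embed x.
Proof.
move=> xD Aa; apply: psiP => k l; apply: (@psi_pow_inj m).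
apply/funext => i; apply/funext => j; rewrite !psiME.
rewrite !(addmap_sum (fun x y => psi_powD x y i j)).
pose a' := psi' (\matrix_(i0, j0) psi_pow psi m (psi a i0 j0) i j).
have /matrixP/(_ k l) : x *m phi1 psi phi a' = phi1 psi phi a' *m x.
  by apply: xD; exists a'; split=> //; exact: A_slice.
rewrite !mxE => /(congr1 (fun c => c *: (1 : B))); rewrite !scaler_suml => H.
transitivity (\sum_p (x k p * phi1 psi phi a' p l) *: (1 : B)).
  apply: eq_bigr => p _.
  by rewrite psi_embed -scalerAl mul1r psi_powZ psi_cexp psi_pow_cexp scalerA !mxE psi'K mxE.
rewrite H; apply: eq_bigr => p _.
by rewrite psi_embed -scalerAr mulr1 psi_powZ psi_cexp psi_pow_cexp scalerA !mxE psi'K mxE mulrC.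
Qed.

(** Here the maximality of the intersection of [A] with C enters: kappa_1(x) is in C and commutes
    with that intersection, by approximation with [cexp]. *)
Lemma embed_commutant x : (forall M, D M -> x *m M = M *m x) -> A (embed x).
Proof.
move=> xD; suff [] : A (embed x) /\ Cset nrm psi (embed x) by [].
apply: (masa_commutant Cset_star_subalg masaAC (Cset_embed x)) => c [Ac Cc].
by apply: commute_Cset => // m; exact: embed_comm_cexp.
Qed.

Lemma masa_D : masa_Mn D.
Proof.
split=> //; split; last split=> // S' _ _ S'ab DS' x S'x.
  split; first exact: D0.
  split; first exact: DD.
  split; first exact: DZ.
  split=> [M N [a [Aa ->]] [b [Ab ->]]|M [a [Aa ->]]].
    by exists (a * b); rewrite phi1M//; split=> //; exact: AM.
  exists (star a); split; first exact: A_star.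
  by apply/matrixP => i j; rewrite !mxE psi_starE phi_star.
(* An element x of a larger abelian [S'] commutes with [D], so kappa_1(x) lies in [A] and is the
   required preimage of x under phi_1. *)
exists (embed x); rewrite phi1_embed; split=> //; apply: embed_commutant => M /DS'.
exact: S'ab.
Qed.

(** Recursively, kappa_(m+1)(d_0 (x) d') = kappa_1(d_0) sigma_1(kappa_m(d')). The first factor is in
    [A] because [D] is abelian, the second because [A] is invariant under sigma_1. *)
Lemma A_elementary_tensor m (d : 'I_m -> 'M[R[i]]_n) : (forall r, D (d r)) ->
  exists b, A b /\ psi_pow psi m b = tens1 B (fun i j => \prod_r d r (i r) (j r)).
Proof.
elim: m d => [|m IH] d Dd.
  exists 1; split; first by apply: A_commutant => y _; rewrite mul1r mulr1.
  by apply/funext => i; apply/funext => j; rewrite /tens1 big_ord0 scale1r.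
have [|b [Ab bE]] := IH (fun r => d (lift ord0 r)); first by move=> r; exact: Dd.
exists (embed (d ord0) * shift b); split.
  by apply/AM/A_shift => //; apply: embed_commutant => M; exact: D_abelian.
apply/funext => i; apply/funext => j.
rewrite psi_powS psi_mul_shift psi_embed -scalerAl mul1r psi_powZ bE /tens1 scalerA.
by rewrite big_ord_recl.
Qed.

Lemma A_tensor m (x : Mt R[i] n m) b : tensor_pow D x -> psi_pow psi m b = tens1 B x -> A b.
Proof.
move=> [k [c [d [Dd ->]]]] bE.
have /fin_all_exists[e eP] l := A_elementary_tensor (Dd l).
rewrite (_ : b = \sum_l c l *: e l).
  by elim/big_ind: _ => [||l _]; [exact: A0|exact: AD|apply: AZ; case: (eP l)].
apply: (@psi_pow_inj m); apply/funext => i; apply/funext => j.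
rewrite bE (addmap_sum (fun x y => psi_powD x y i j)) /tens1 scaler_suml.
by apply: eq_bigr => l _; rewrite psi_powZ; case: (eP l) => _ ->; rewrite /tens1 scalerA.
Qed.

Lemma AC_Dinf b : (A b /\ Cset nrm psi b) <-> Dinf nrm psi D b.
Proof.
split=> [[Ab Cb] e e0|Db].
  have [m [m0 be]] := cexp_approx Cb e0; exists (cexp m b); split=> //; exists m; split=> //.
  by eexists; split; [exact: (phi_pow_tensor m Ab)|exact: psi_pow_cexp].
split.
  apply: (masa_closed masaA); apply: nclosure_mono Db => y [m [_ [x [xD yx]]]].
  exact: (A_tensor xD yx).
by apply: nclosure_mono Db => y [m [m0 [x [_ yx]]]]; exists m; split=> //; exists x.
Qed.

End Masa.

End Tower.
End CstarAlgebra.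

Theorem theorem3p10 (R : realType) (B : algType R[i]) (star : B -> B) (nrm : B -> R)
  (n : nat) (psi : B -> 'M[B]_n) (A : B -> Prop) (phi : B -> R[i]) :
  is_Cstar_algebra star nrm ->
  (* psi : B -> M_n (x) B is a *-isomorphism with psi(1) = I_n (x) 1 *)
  (forall x y, psi (x + y) = psi x + psi y) ->
  (forall (c : R[i]) x, psi (c *: x) = \matrix_(i, j) (c *: psi x i j)) ->
  (forall x y, psi (x * y) = psi x *m psi y) ->
  (forall x, psi (star x) = \matrix_(i, j) star (psi x j i)) ->
  bijective psi ->
  psi 1 = 1%:M ->
  (* A is a maximal abelian *-subalgebra of B, invariant under sigma_1, sigma_2 *)
  masa_B star (fun _ => True) A ->
  (forall a b, A a -> sigma_graph psi 0 a b -> A b) ->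
  (forall a b, A a -> sigma_graph psi 1 a b -> A b) ->
  (* phi : B -> C is a positive contraction (linear) ... *)
  (forall x y, phi (x + y) = phi x + phi y) ->
  (forall (c : R[i]) x, phi (c *: x) = c * phi x) ->
  (forall x, 0 <= phi (star x * x)) ->
  (forall x, (`|phi x| <= (nrm x)%:C)%C) ->
  (* ... whose restriction to A is a unital algebra homomorphism *)
  phi 1 = 1 ->
  (forall a a', A a -> A a' -> phi (a * a') = phi a * phi a') ->
  (* A /\ C is maximal abelian in C *)
  masa_B star (Cset nrm psi) (fun b => A b /\ Cset nrm psi b) ->
  let D := fun M : 'M[R[i]]_n => exists a, A a /\ M = phi1 psi phi a in
  (forall b, (A b /\ Cset nrm psi b) <-> Dinf nrm psi D b) /\ masa_Mn D.
Proof.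
move=> cstar psiD psiZ psiM psi_star [psi' psiK psi'K] psi1 masaA A1 A2 phiD phiZ phi_ge0 _.
move=> phi_one phiM masaAC D; split.
  exact: (AC_Dinf cstar psiD psiZ psiM psi_star psiK psi'K psi1 phiD phiZ phi_ge0 phi_one
    masaA A1 A2 phiM masaAC).
exact: (masa_D cstar psiD psiZ psiM psi_star psiK psi'K psi1 phiD phiZ phi_ge0 phi_one
    masaA A1 A2 phiM masaAC).
Qed.
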